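(* The weight function $$w_7(\lambda,x)=\frac{\log(1+\lambda+x)}{\lambda+x}\cdot\frac{x}{\log(1+x)},\qquad \lambda>0,\ x>0,$$ is $\mathrm{STP}_\infty$.
   Context: A real function $w(\lambda,x)$ on $(0,\infty)\times(0,\infty)$ is $\mathrm{STP}_\infty$ (strictly totally positive of order infinity) if for every $r\ge 1$, all $\lambda_1>\cdots>\lambda_r>0$ and all $x_1>\cdots>x_r>0$, the $r\times r$ determinant $\det(w(\lambda_i,x_j))$ is $>0$. *)

(* Defs.v *)
From HB Require Import structures.
From mathcomp Require Import all_boot all_order all_algebra.
From mathcomp Require Import reals exp.

Set Implicit Arguments.
Unset Strict Implicit.
Unset Printing Implicit Defensive.

Import Order.TTheory GRing.Theory Num.Theory.
Local Open Scope ring_scope.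

(* A function on (0, +oo) x (0, +oo) is represented by a total function
   R -> R -> R; only its values at positive arguments matter here.
   The points are listed in strictly decreasing order, so i < j gives
   l j < l i. *)
Definition STP_infty (R : realType) (w : R -> R -> R) : Prop :=
  forall (r : nat) (l x : 'I_r -> R),
    (1 <= r)%N ->
    (forall i, 0 < l i) -> (forall i j : 'I_r, (i < j)%N -> l j < l i) ->
    (forall i, 0 < x i) -> (forall i j : 'I_r, (i < j)%N -> x j < x i) ->
    0 < \det (\matrix_(i < r, j < r) w (l i) (x j)).

Definition w7 (R : realType) (l x : R) : R :=
  ln (1 + l + x) / (l + x) * (x / ln (1 + x)).

(* Main.v *)
Require Import Defs.
From HB Require Import structures.
From mathcomp Require Import all_boot all_order all_algebra.
From mathcomp Require Import reals exp.
From mathcomp Require Import all_fingroup.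
From mathcomp Require Import ring lra zify.
From mathcomp Require Import boolp classical_sets topology normedtype sequences.

Set Implicit Arguments.
Unset Strict Implicit.
Unset Printing Implicit Defensive.

Import Order.TTheory GRing.Theory Num.Theory.
Import numFieldNormedType.Exports.
Local Open Scope classical_set_scope.
Local Open Scope ring_scope.

(** The factor x / log(1+x) only rescales columns, so it suffices to treat
    log(1+s)/s = int_1^oo dt / (t (s+t)) at s = lambda + x: a positive mixture
    of Cauchy kernels 1/(lambda + x + t), approximated by Riemann sums.
    With p = 1 - h lambda, q = 1 - h x, tau = 1 - h t, the kernel
    1/(lambda + x + t) is the limit of h/(1 - p q tau) as h -> 0+, so a mixture
    of Cauchy kernels is a limit of power series sum_k c_k (p q)^k, c_k >= 0.
    By the Cauchy-Binet formula and the nonnegativity of generalized Vandermonde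
    determinants, det(sum_k c_k (p_i q_j)^k) is nondecreasing in each c_k.
    As the part t <= 2 of the mixture has mass at least 1/2, the coefficients
    dominate those of the single kernel (1/2)/(lambda + x + 2); this inequality
    survives in the limit and bounds the determinant from below by a positive
    Cauchy determinant, which gives strict positivity. *)

(** * Column clearing and the Cauchy determinant *)

Lemma det_scale (R : comNzRingType) n (a b : 'I_n -> R)
    (M : 'I_n -> 'I_n -> R) :
  \det (\matrix_(i, j) (a i * M i j * b j)) =
  (\prod_i a i) * (\prod_j b j) * \det (\matrix_(i, j) M i j).
Proof.
have -> : \matrix_(i, j) (a i * M i j * b j) =
    diag_mx (\row_i a i) *m (\matrix_(i, j) M i j) *m diag_mx (\row_j b j).
  by rewrite mul_mx_diag mul_diag_mx; apply/matrixP => i j; rewrite !mxE.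
rewrite !det_mulmx !det_diag mulrAC; congr (_ * _ * _).
- by apply: eq_bigr => i _; rewrite mxE.
- by apply: eq_bigr => i _; rewrite mxE.
Qed.

(** Right multiplication by [U] subtracts [c j] times column [b j] from column [lift 0 j]. Since
    [b j <= j], the column subtracted lies strictly to the left, so [U] is unitriangular and the
    determinant is unchanged; row 0 of the product vanishes outside its corner. *)
Lemma det_clear_row0 (R : comNzRingType) n (A : 'M[R]_n.+1)
    (b : 'I_n -> 'I_n.+1) (c : 'I_n -> R) :
  (forall j, (b j <= j)%N) ->
  (forall j, A 0 (lift 0 j) = c j * A 0 (b j)) ->
  \det A = A 0 0 *
    \det (\matrix_(i, j) (A (lift 0 i) (lift 0 j) - c j * A (lift 0 i) (b j))).
Proof.
move=> bj A0.
pose U : 'M[R]_n.+1 := \matrix_(k, j) ((k == j)%:R -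
   if unlift 0 j is Some j' then (k == b j')%:R * c j' else 0).
have AU0 i : (A *m U) i 0 = A i 0.
  rewrite mxE (bigD1 0) //= !mxE unlift_none eqxx subr0 mulr1.
  rewrite big1 ?addr0 // => k k0.
  by rewrite mxE unlift_none (negPf k0) subr0 mulr0.
have AUS i j : (A *m U) i (lift 0 j) = A i (lift 0 j) - c j * A i (b j).
  rewrite mxE.
  under eq_bigr do rewrite mxE liftK mulrBr.
  rewrite sumrB (bigD1 (lift 0 j)) //= eqxx mulr1 big1 ?addr0; last first.
    by move=> k kj; rewrite (negPf kj) mulr0.
  rewrite (bigD1 (b j)) //= eqxx mul1r big1 ?addr0; last first.
    by move=> k kj; rewrite (negPf kj) mul0r mulr0.
  by rewrite [A i (b j) * _]mulrC.
have detU : \det U = 1.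
  rewrite -det_tr det_trig; last first.
    apply/is_trig_mxP => i j ij; rewrite !mxE -val_eqE /= gtn_eqF // sub0r.
    case: unliftP => [i' ii'|]; last by rewrite oppr0.
    have -> : (j == b i') = false; last by rewrite mul0r oppr0.
    apply/negP => /eqP jb; move: ij; rewrite jb ii' lift0.
    by rewrite ltnNge leqW ?bj.
  rewrite big1 // => i _; rewrite !mxE eqxx.
  case: unliftP => [j ->|]; last by rewrite subr0.
  have -> : (lift 0 j == b j) = false; last by rewrite mul0r subr0.
  by rewrite -val_eqE /= gtn_eqF // ltnS.
rewrite -[\det A]mulr1 -detU -det_mulmx (expand_det_row _ 0) big_ord_recl big1.
  rewrite addr0 AU0 /cofactor expr0 mul1r; congr (_ * \det _).
  by apply/matrixP => i j; rewrite mxE [RHS]mxE [LHS]mxE AUS.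
by move=> j _; rewrite AUS A0 subrr mul0r.
Qed.

(** Clearing row 0 with column 0 leaves the Cauchy matrix of the remaining nodes, up to row factors
    [(x 0 - x i) / (x i + y 0)] and column factors [(y 0 - y j) / (x 0 + y j)], all positive;
    induction concludes. *)
Lemma det_cauchy_gt0 (R : realFieldType) n (x y : 'I_n -> R) :
  (forall i j, 0 < x i + y j) ->
  (forall i j : 'I_n, (i < j)%N -> x j < x i) ->
  (forall i j : 'I_n, (i < j)%N -> y j < y i) ->
  0 < \det (\matrix_(i, j) (x i + y j)^-1).
Proof.
elim: n x y => [|n IH] x y xy0 xd yd; first by rewrite det_mx00 ltr01.
have nz i j : x i + y j != 0 by rewrite gt_eqF.
rewrite (@det_clear_row0 _ _ _ (fun=> 0)
  (fun j => (x 0 + y 0) / (x 0 + y (lift 0 j)))) //; last first.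
  by move=> j; rewrite !mxE mulrAC mulfV // mul1r.
rewrite mxE mulr_gt0 ?invr_gt0 //.
have -> : \matrix_(i, j)
    ((\matrix_(i0, j0) (x i0 + y j0)^-1) (lift 0 i) (lift 0 j) -
      (x 0 + y 0) / (x 0 + y (lift 0 j)) *
      (\matrix_(i0, j0) (x i0 + y j0)^-1) (lift 0 i) 0) =
    \matrix_(i, j) ((x 0 - x (lift 0 i)) / (x (lift 0 i) + y 0) *
      (x (lift 0 i) + y (lift 0 j))^-1 *
      ((y 0 - y (lift 0 j)) / (x 0 + y (lift 0 j)))).
  apply/matrixP => i j; rewrite !mxE.
  by field; rewrite !nz.
rewrite (det_scale _ _ (fun i j => (x (lift 0 i) + y (lift 0 j))^-1)).
rewrite !mulr_gt0 //.
- by apply: prodr_gt0 => i _; rewrite divr_gt0 // subr_gt0 xd.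
- by apply: prodr_gt0 => i _; rewrite divr_gt0 // subr_gt0 yd.
- by apply: IH => // i j ij; [apply: xd | apply: yd]; rewrite !lift0 ltnS.
Qed.

(** * Generalized Vandermonde determinants *)

Lemma det_sum_cols (R : comNzRingType) n (J : finType) (Q : 'I_n -> pred J)
    (F : 'I_n -> 'I_n -> J -> R) :
  \det (\matrix_(i, j) \sum_(m | Q j m) F i j m) =
  \sum_(f in family Q) \det (\matrix_(i, j) F i j (f j)).
Proof.
rewrite -det_tr /determinant.
under eq_bigr => s _.
  under eq_bigr do rewrite !mxE.
  rewrite bigA_distr_big_dep mulr_sumr; over.
rewrite exchange_big /=; apply: eq_bigr => f _.
rewrite -[RHS]det_tr; apply: eq_bigr => s _.
by congr (_ * _); apply: eq_bigr => i _; rewrite !mxE.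
Qed.

(** This is [x ^+ k] times the usual factorization of a difference of powers. The sum is indexed by
    the actual exponent [m] of [x], so that exponents coming from different columns can be
    compared. *)
Lemma subrXX_shift (R : comPzRingType) (x y : R) (k l : nat) : (k <= l)%N ->
  x ^+ l - y ^+ (l - k) * x ^+ k =
  (x - y) * \sum_(k <= m < l) y ^+ (l.-1 - m) * x ^+ m.
Proof.
move=> /subnKC <-; elim: (l - k)%N => [|d IH].
  by rewrite addn0 subnn expr0 mul1r subrr big_geq ?mulr0.
rewrite addnS big_nat_recr ?leq_addr //= subnn expr0 mul1r mulrDr.
have -> : \sum_(k <= i < k + d) y ^+ (k + d - i) * x ^+ i =
    y * \sum_(k <= i < k + d) y ^+ ((k + d).-1 - i) * x ^+ i.
  rewrite mulr_sumr; apply: eq_big_nat => m /andP[_ md].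
  by rewrite mulrA -exprS -subn1 subnAC subn1 prednK // subn_gt0.
rewrite mulrCA -IH subSn ?leq_addr // !exprS.
ring.
Qed.

(* Clearing row 0 with consecutive columns leaves the entries
   (p_i - p_0) * sum_(k_j <= m < k_(j+1)) p_0^(k_(j+1)-1-m) p_i^m; the exponent
   ranges of distinct columns are disjoint and ordered, so column multilinearity
   yields only generalized Vandermonde determinants of smaller size. *)
Lemma det_powers_ge0 (R : realDomainType) n (p : 'I_n -> R) (k : 'I_n -> nat) :
  (forall i, 0 <= p i) ->
  (forall i j : 'I_n, (i < j)%N -> p i <= p j) ->
  (forall i j : 'I_n, (i < j)%N -> (k i < k j)%N) ->
  0 <= \det (\matrix_(i, j) p i ^+ k j).
Proof.
elim: n p k => [|n IH] p k p0 pi ki; first by rewrite det_mx00 ler01.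
pose b (j : 'I_n) : 'I_n.+1 := widen_ord (leqnSn n) j.
have kb j : (k (b j) <= k (lift ord0 j))%N by rewrite ltnW // ki.
rewrite (@det_clear_row0 _ _ _ b
  (fun j => p ord0 ^+ (k (lift ord0 j) - k (b j)))) //; last first.
  by move=> j; rewrite !mxE -exprD subnK.
rewrite mxE mulr_ge0 ?exprn_ge0 //.
(* A common bound on the exponents, needed because [det_sum_cols] sums over one finite type for all
   columns. *)
pose D := \max_j k j.
pose Q (j : 'I_n) (m : 'I_D) := (k (b j) <= m < k (lift ord0 j))%N.
pose w (j : 'I_n) (m : 'I_D) := p ord0 ^+ ((k (lift ord0 j)).-1 - m).
have -> : \matrix_(i, j)
    ((\matrix_(i0, j0) p i0 ^+ k j0) (lift ord0 i) (lift ord0 j) -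
      p ord0 ^+ (k (lift ord0 j) - k (b j)) *
      (\matrix_(i0, j0) p i0 ^+ k j0) (lift ord0 i) (b j)) =
    \matrix_(i, j) ((p (lift ord0 i) - p ord0) *
      (\sum_(m | Q j m) w j m * p (lift ord0 i) ^+ m) * 1).
  apply/matrixP => i j; rewrite !mxE subrXX_shift // mulr1; congr (_ * _).
  rewrite big_geq_mkord (big_ord_widen_cond D (leq (k (b j)))
    (fun m => p ord0 ^+ ((k (lift ord0 j)).-1 - m) * p (lift ord0 i) ^+ m)) //.
  exact: leq_bigmax.
rewrite (det_scale _ _
  (fun i j => \sum_(m | Q j m) w j m * p (lift ord0 i) ^+ m)).
rewrite big1_eq mulr1 mulr_ge0 //.
  by apply: prodr_ge0 => i _; rewrite subr_ge0 pi.
rewrite det_sum_cols; apply: sumr_ge0 => f /familyP fQ.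
have -> : \matrix_(i, j) (w j (f j) * p (lift ord0 i) ^+ f j) =
    \matrix_(i, j) (1 * p (lift ord0 i) ^+ f j * w j (f j)).
  by apply/matrixP => i j; rewrite !mxE mul1r mulrC.
rewrite (det_scale _ _ (fun i j => p (lift ord0 i) ^+ f j)) big1_eq mul1r.
rewrite mulr_ge0 //.
  by apply: prodr_ge0 => i _; rewrite exprn_ge0.
apply: (IH (fun i => p (lift ord0 i)) (fun j => f j)) => // i j ij.
  by rewrite pi // !lift0.
(* The chain is [f i < k (lift ord0 i) <= k (b j) <= f j]: column [b j] is [lift ord0 i] itself when
   j = i + 1, and lies to its right otherwise. *)
have /andP[_ fi] := fQ i; have /andP[fj _] := fQ j.
apply: leq_trans fi (leq_trans _ fj).
have [->//|ne] := eqVneq (b j) (lift ord0 i).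
rewrite ltnW // ki // lift0 /= ltn_neqAle ij andbT.
by apply: contra ne => /eqP e; apply/eqP/val_inj; rewrite /= -e.
Qed.

(** * Cauchy-Binet and monotonicity in the coefficients *)

Lemma sort_inj_perm n (k : 'I_n -> nat) : injective k ->
  exists s : 'S_n, forall i j : 'I_n, (i < j)%N -> (k (s i) < k (s j))%N.
Proof.
move=> kI; pose t := [tuple k i | i < n].
have ps : perm_eq (sort leq t) t by rewrite perm_sort.
have /tuple_permP [s es] := ps; exists s => i j ij.
have nthE (l : 'I_n) : nth 0%N (sort leq t) l = k (s l).
  by rewrite es -tnth_nth !tnth_mktuple.
have us : uniq t by rewrite map_inj_uniq ?enum_uniq.
have : sorted ltn (sort leq t).
  by rewrite ltn_sorted_uniq_leq sort_uniq us sort_sorted //; exact: leq_total.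
move=> /(sorted_ltn_nth ltn_trans 0%N)/(_ i j).
rewrite !inE !size_sort !size_tuple !ltn_ord => /(_ isT isT ij).
by rewrite !nthE.
Qed.

Lemma det_col_perm (R : comNzRingType) n (M : 'I_n -> 'I_n -> R) (s : 'S_n) :
  \det (\matrix_(i, j) M i (s j)) = (-1) ^+ s * \det (\matrix_(i, j) M i j).
Proof.
have -> : \matrix_(i, j) M i (s j) = col_perm s (\matrix_(i, j) M i j).
  by apply/matrixP => i j; rewrite !mxE.
by rewrite col_permE det_mulmx det_perm odd_permV mulrC.
Qed.

(** Sorting the exponents multiplies both determinants by the same sign, which cancels in the
    product. A repeated exponent gives two equal columns. *)
Lemma det_powers_mul_ge0 (R : realDomainType) n (p q : 'I_n -> R)
    (k : 'I_n -> nat) :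
  (forall i, 0 <= p i) -> (forall i, 0 <= q i) ->
  (forall i j : 'I_n, (i < j)%N -> p i <= p j) ->
  (forall i j : 'I_n, (i < j)%N -> q i <= q j) ->
  0 <= \det (\matrix_(i, j) p i ^+ k j) * \det (\matrix_(i, j) q i ^+ k j).
Proof.
move=> p0 q0 pi qi.
have [/injectiveP kI|] := boolP (injectiveb k); last first.
  move=> /injectivePn [i [j ij kij]].
  rewrite -det_tr (determinant_alternate ij) ?mul0r // => l.
  by rewrite !mxE kij.
have [s ks] := sort_inj_perm kI.
rewrite -[leRHS]mul1r -(sqrr_sign R s) expr2 mulrACA.
rewrite -!(det_col_perm (fun i j => _ i ^+ k j)) mulr_ge0 //.
  exact: (@det_powers_ge0 _ _ p (k \o s)).
exact: (@det_powers_ge0 _ _ q (k \o s)).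
Qed.

(* Cauchy-Binet summed over all maps instead of increasing ones, whence the
   factor n!; this avoids sorting inside the sum. *)
Lemma det_sum_sym (R : comNzRingType) n (J : finType) (a b : 'I_n -> J -> R)
    (c : J -> R) :
  \det (\matrix_(i, j) \sum_m c m * a i m * b j m) *+ n`! =
  \sum_(f : {ffun 'I_n -> J}) (\prod_i c (f i)) *
    (\det (\matrix_(i, j) a i (f j)) * \det (\matrix_(i, j) b i (f j))).
Proof.
pose T (f : {ffun 'I_n -> J}) := \det (\matrix_(i, j) a i (f j)).
have E : \det (\matrix_(i, j) \sum_m c m * a i m * b j m) =
    \sum_(f : {ffun 'I_n -> J}) (\prod_i c (f i)) * (\prod_i b i (f i)) * T f.
  rewrite det_sum_cols; apply: eq_big => [f|f _]; first by apply/familyP.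
  have -> : \matrix_(i, j) (c (f j) * a i (f j) * b j (f j)) =
     \matrix_(i, j) (1 * a i (f j) * (c (f j) * b j (f j))).
    by apply/matrixP => i j; rewrite !mxE mul1r; ring.
  by rewrite (det_scale _ _ (fun i j => a i (f j))) big1_eq mul1r big_split.
(* The n! copies are indexed by permutations [s]. In copy [s], reindexing [f] by [s] preserves the
   product of the [c] and multiplies [T f] by the sign of [s]; summing over [s] then rebuilds the
   determinant of [b]. *)
rewrite -card_Sn -cardsT -sumr_const.
transitivity (\sum_(s : 'S_n) \sum_(f : {ffun 'I_n -> J})
    (\prod_i c (f i)) * T f * ((-1) ^+ s * \prod_i b i (f (s i)))).
  apply: eq_big => [s|s _]; first by rewrite inE.
  pose h (f : {ffun 'I_n -> J}) : {ffun 'I_n -> J} := [ffun i => f (s i)].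
  have hb : bijective h.
    exists (fun f : {ffun 'I_n -> J} => [ffun i => f ((s^-1)%g i)]) => f;
    apply/ffunP => i; by rewrite !ffunE ?permK ?permKV.
  rewrite E (reindex h) /=; last exact: onW_bij.
  apply: eq_bigr => f _.
  have -> : T (h f) = (-1) ^+ s * T f.
    rewrite /T -(det_col_perm (fun i j => a i (f j))); congr (\det _).
    by apply/matrixP => i j; rewrite !mxE ffunE.
  have -> : \prod_i c (h f i) = \prod_i c (f i).
    rewrite [RHS](reindex_perm s) /=.
    by apply: eq_bigr => i _; rewrite ffunE.
  have -> : \prod_i b i (h f i) = \prod_i b i (f (s i)).
    by apply: eq_bigr => i _; rewrite ffunE.
  by rewrite -!mulrA; congr (_ * _); rewrite mulrC -mulrA mulrCA.
rewrite exchange_big /=; apply: eq_bigr => f _.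
rewrite -mulr_sumr mulrA; congr (_ * _).
by apply: eq_bigr => s _; congr (_ * _); apply: eq_bigr => i _; rewrite mxE.
Qed.

Lemma ler_det_power_sum (R : realDomainType) n (p q : 'I_n -> R) (K : nat)
    (c d : nat -> R) :
  (forall i, 0 <= p i) -> (forall i, 0 <= q i) ->
  (forall i j : 'I_n, (i < j)%N -> p i <= p j) ->
  (forall i j : 'I_n, (i < j)%N -> q i <= q j) ->
  (forall k, 0 <= c k <= d k) ->
  \det (\matrix_(i, j) \sum_(k < K) c k * (p i * q j) ^+ k) <=
  \det (\matrix_(i, j) \sum_(k < K) d k * (p i * q j) ^+ k).
Proof.
move=> p0 q0 pi qi cd.
have E (e : nat -> R) : \matrix_(i, j) \sum_(k < K) e k * (p i * q j) ^+ k =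
    \matrix_(i, j) \sum_(k : 'I_K) e k * p i ^+ k * q j ^+ k.
  apply/matrixP => i j; rewrite !mxE; apply: eq_bigr => k _.
  by rewrite exprMn mulrA.
rewrite !E -(ler_pMn2r (fact_gt0 n)).
rewrite !(@det_sum_sym _ _ _ (fun i (k : 'I_K) => p i ^+ k)
  (fun i (k : 'I_K) => q i ^+ k) (fun k : 'I_K => _ (k : nat))).
apply: ler_sum => f _; apply: ler_wpM2r.
  exact: (@det_powers_mul_ge0 _ _ p q (fun j => f j)).
by apply: ler_prod => i _; exact: cd.
Qed.

(** * From power series to Cauchy kernels by limits *)

Lemma det_cvg (R : realType) n (A : nat -> 'M[R]_n) (B : 'M[R]_n) :
  (forall i j, A k i j @[k --> \oo] --> B i j) ->
  \det (A k) @[k --> \oo] --> \det B.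
Proof.
move=> AB; apply: cvg_big => [|s _]; first exact: add_continuous.
apply: cvgM; first exact: cvg_cst.
by apply: cvg_big => [|i _]; [exact: mul_continuous | exact: AB].
Qed.

Lemma ler_det_cvg (R : realType) n (A A' : nat -> 'M[R]_n) (B B' : 'M[R]_n) :
  (forall i j, A k i j @[k --> \oo] --> B i j) ->
  (forall i j, A' k i j @[k --> \oo] --> B' i j) ->
  (\forall k \near \oo, \det (A k) <= \det (A' k)) ->
  \det B <= \det B'.
Proof. by move=> /det_cvg AB /det_cvg AB'; apply: ler_cvg_to AB AB'. Qed.

(** Both sides expand in geometric series. The moment [d k] is at least [W * T ^+ k], because the
    nodes with [T <= tau m] alone have mass at least [W]. The truncated determinants are compared
    before letting [K] grow. *)
Lemma ler_det_geometric (R : realType) n (p q : 'I_n -> R) N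
    (w tau : 'I_N -> R) (W T : R) :
  (forall i, 0 <= p i < 1) -> (forall i, 0 <= q i < 1) ->
  (forall i j : 'I_n, (i < j)%N -> p i <= p j) ->
  (forall i j : 'I_n, (i < j)%N -> q i <= q j) ->
  (forall m, 0 <= w m) -> (forall m, 0 <= tau m <= 1) ->
  0 <= W -> 0 <= T <= 1 -> W <= \sum_(m | T <= tau m) w m ->
  \det (\matrix_(i, j) (W / (1 - p i * q j * T))) <=
  \det (\matrix_(i, j) \sum_m w m / (1 - p i * q j * tau m)).
Proof.
move=> p01 q01 pi qi w0 t01 W0 T01 Ww.
pose c k := W * T ^+ k; pose d k := \sum_m w m * tau m ^+ k.
have geo (v t : R) i j : 0 <= t <= 1 ->
    (\sum_(k < K) v * t ^+ k * (p i * q j) ^+ k) @[K --> \oo] -->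
    v / (1 - p i * q j * t).
  move=> /andP[t0 t1]; set z := p i * q j * t.
  have /andP[pi0 pi1] := p01 i; have /andP[qj0 qj1] := q01 j.
  have z1 : `|z| < 1.
    rewrite ger0_norm ?mulr_ge0 //; apply: le_lt_trans pi1.
    by rewrite /z -mulrA ler_piMr // mulr_ile1 // ltW.
  have := @cvg_geometric_series R v z z1.
  apply: cvg_trans; apply: near_eq_cvg; near=> K.
  rewrite /series /= big_mkord; apply: eq_bigr => k _.
  by rewrite /geometric /= -mulrA -exprMn /z [t * _]mulrC.
apply: (@ler_det_cvg R n
  (fun K => \matrix_(i, j) \sum_(k < K) c k * (p i * q j) ^+ k)
  (fun K => \matrix_(i, j) \sum_(k < K) d k * (p i * q j) ^+ k)).
- move=> i j; rewrite mxE.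
  by under eq_fun do rewrite mxE; exact: geo.
- move=> i j; rewrite mxE; under eq_fun do rewrite mxE /d.
  have -> : (fun K =>
      \sum_(k < K) (\sum_m w m * tau m ^+ k) * (p i * q j) ^+ k) =
    (fun K => \sum_m \sum_(k < K) w m * tau m ^+ k * (p i * q j) ^+ k).
    apply/funext => K; rewrite exchange_big /=; apply: eq_bigr => k _.
    by rewrite mulr_suml.
  by apply: cvg_big => [|m _]; [exact: add_continuous | exact: geo].
near=> K; apply: ler_det_power_sum => //.
- by move=> i; case/andP: (p01 i).
- by move=> i; case/andP: (q01 i).
move=> k; have /andP[T0 T1] := T01; rewrite mulr_ge0 ?exprn_ge0 //=.
apply: (@le_trans _ _ (\sum_(m | T <= tau m) w m * T ^+ k)).
  by rewrite -mulr_suml ler_wpM2r ?exprn_ge0.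
rewrite /d [leRHS](bigID (fun m => T <= tau m)) /= -[leLHS]addr0 lerD //.
  apply: ler_sum => m Tm; rewrite ler_wpM2l // lerXn2r //.
    by rewrite nnegrE (le_trans T0).
apply: sumr_ge0 => m _; rewrite mulr_ge0 ?exprn_ge0 //.
by case/andP: (t01 m).
Unshelve. all: by end_near. Qed.

(** The denominator is exactly [harmonic k * g k], where [g k] tends to [a + b + c], so the small
    factor cancels. *)
Lemma cvg_harmonic_cauchy (R : realType) (a b c : R) : 0 < a + b + c ->
  harmonic k / (1 - (1 - harmonic k * a) * (1 - harmonic k * b) *
    (1 - harmonic k * c)) @[k --> \oo] --> (a + b + c)^-1.
Proof.
move=> abc0.
pose g (k : nat) : R := a + b + c - harmonic k *
  (a * b + b * c + a * c - harmonic k * (a * b * c)).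
have hc := @cvg_harmonic R.
have gE : g k @[k --> \oo] --> a + b + c.
  rewrite -[X in _ --> X]subr0; apply: cvgB; first exact: cvg_cst.
  rewrite -[X in _ --> X](mul0r (a * b + b * c + a * c - 0 * (a * b * c))).
  apply: cvgM => //; apply: cvgB; first exact: cvg_cst.
  by apply: cvgM => //; exact: cvg_cst.
apply: cvg_trans (cvgV (lt0r_neq0 abc0) gE).
apply: near_eq_cvg; near=> k.
have h0 : harmonic k != 0 :> R by rewrite gt_eqF // harmonic_gt0.
rewrite /=; set h := harmonic k in h0 *.
have -> : 1 - (1 - h * a) * (1 - h * b) * (1 - h * c) = h * g k.
  by rewrite /g -/h; ring.
by rewrite invfM mulrA mulfV // mul1r.
Unshelve. all: by end_near. Qed.

(** The decreasing map c -> 1 - h c makes the nodes increasing and turns [t m <= T] into the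
    condition on [tau] in [ler_det_geometric]. *)
Lemma ler_det_cauchy_sum (R : realType) n (l x : 'I_n -> R) N
    (w t : 'I_N -> R) (W T : R) :
  (forall i, 0 < l i) -> (forall i j : 'I_n, (i < j)%N -> l j < l i) ->
  (forall i, 0 < x i) -> (forall i j : 'I_n, (i < j)%N -> x j < x i) ->
  (forall m, 0 <= w m) -> (forall m, 0 <= t m) ->
  0 <= W -> 0 <= T -> W <= \sum_(m | t m <= T) w m ->
  \det (\matrix_(i, j) (W / (l i + x j + T))) <=
  \det (\matrix_(i, j) \sum_m w m / (l i + x j + t m)).
Proof.
move=> l0 ld x0 xd w0 t0 W0 T0 Ww.
pose h (k : nat) : R := harmonic k.
have h0 k : 0 < h k by exact: harmonic_gt0.
have geo (v c : R) i j : 0 <= c ->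
    v * h k / (1 - (1 - h k * l i) * (1 - h k * x j) * (1 - h k * c))
      @[k --> \oo] --> v / (l i + x j + c).
  move=> c0; under eq_fun do rewrite -mulrA.
  apply: cvgM; first exact: cvg_cst.
  by apply: cvg_harmonic_cauchy; rewrite ltr_wpDr // addr_gt0.
apply: (@ler_det_cvg R n
  (fun k => \matrix_(i, j) (W * h k /
     (1 - (1 - h k * l i) * (1 - h k * x j) * (1 - h k * T))))
  (fun k => \matrix_(i, j) \sum_m (w m * h k /
     (1 - (1 - h k * l i) * (1 - h k * x j) * (1 - h k * t m))))).
- move=> i j; rewrite mxE.
  by under eq_fun do rewrite mxE; exact: geo.
- move=> i j; rewrite mxE; under eq_fun do rewrite mxE.
  by apply: cvg_big => [|m _]; [exact: add_continuous | exact: geo].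
(* [C] dominates every [l i], [x i], [t m] and [T], so a single condition [h k * C <= 1] puts all
   the substituted values in [0, 1]. *)
pose C := \sum_i l i + \sum_i x i + \sum_m t m + T.
have sl i : l i <= \sum_i l i.
  by rewrite (bigD1 i) //= lerDl sumr_ge0 // => *; exact: ltW.
have sx i : x i <= \sum_i x i.
  by rewrite (bigD1 i) //= lerDl sumr_ge0 // => *; exact: ltW.
have st m : t m <= \sum_m t m.
  by rewrite (bigD1 m) //= lerDl sumr_ge0.
have l'0 : 0 <= \sum_i l i by apply: sumr_ge0 => *; exact: ltW.
have x'0 : 0 <= \sum_i x i by apply: sumr_ge0 => *; exact: ltW.
have t'0 : 0 <= \sum_m t m by apply: sumr_ge0.
have hC : h k * C @[k --> \oo] --> 0.
  rewrite -[X in _ --> X](mul0r C).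
  by apply: cvgM; [exact: cvg_harmonic | exact: cvg_cst].
near=> k.
have hk1 : h k * C <= 1.
  near: k; apply: cvgr_le hC _ _; exact: ltr01.
have bnd c : 0 <= c -> c <= C -> 0 <= 1 - h k * c <= 1.
  move=> c0 cC; rewrite subr_ge0 gerBl mulr_ge0 ?(ltW (h0 k)) // andbT.
  by apply: le_trans hk1; rewrite ler_pM2l.
have bnd' c : 0 < c -> c <= C -> 0 <= 1 - h k * c < 1.
  move=> c0 cC; have /andP[-> _] := bnd c (ltW c0) cC.
  by rewrite /= gtrBl mulr_gt0.
apply: ler_det_geometric.
- by move=> i; apply: bnd' => //; have := sl i; rewrite /C; lra.
- by move=> i; apply: bnd' => //; have := sx i; rewrite /C; lra.
- by move=> i j ij; rewrite lerB // ler_pM2l // ltW // ld.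
- by move=> i j ij; rewrite lerB // ler_pM2l // ltW // xd.
- by move=> m; rewrite mulr_ge0 // ltW.
- by move=> m; apply: bnd => //; have := st m; rewrite /C; lra.
- by rewrite mulr_ge0 // ltW.
- by apply: bnd => //; rewrite /C; lra.
rewrite -mulr_suml ler_pM2r //.
under eq_bigl do rewrite lerD2l lerN2 ler_pM2l //.
exact: Ww.
Unshelve. all: by end_near. Qed.

(** * Riemann sums for the logarithm *)

Lemma ln_sub_bounds (R : realType) (a b : R) : 0 < a -> 0 < b ->
  (b - a) / b <= ln b - ln a <= (b - a) / a.
Proof.
have half (u v : R) : 0 < u -> 0 < v -> ln v - ln u <= (v - u) / u.
  move=> u0 v0; rewrite -ln_div ?posrE //.
  have E : v / u = 1 + (v - u) / u by field; rewrite gt_eqF.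
  rewrite {1}E le_ln1Dx //.
  by have := divr_gt0 v0 u0; rewrite E; lra.
move=> a0 b0; rewrite half // andbT -lerN2 opprB -mulNr opprB.
exact: half.
Qed.

(** These are right-endpoint sums for the integral of 1/v from 1 to 1 + m d; the excess of the
    left-endpoint sum telescopes to the last term. *)
Lemma ln_riemann_bounds (R : realType) (d : R) m : 0 <= d ->
  \sum_(k < m) d / (1 + k.+1%:R * d) <= ln (1 + m%:R * d) <=
  \sum_(k < m) d / (1 + k.+1%:R * d) + d * (1 - (1 + m%:R * d)^-1).
Proof.
move=> d0.
have v0 k : 0 < 1 + k%:R * d by rewrite ltr_wpDr // mulr_ge0.
elim: m => [|m /andP[IH1 IH2]].
  by rewrite big_ord0 mul0r addr0 ln1 invr1 subrr mulr0 addr0 lexx.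
rewrite big_ord_recr /=.
have /andP[] := ln_sub_bounds (v0 m) (v0 m.+1).
have -> : 1 + m.+1%:R * d - (1 + m%:R * d) = d by rewrite -natr1; ring.
move: IH1 IH2; rewrite mulrBr mulr1 mulrBr mulr1; lra.
Qed.

(* Riemann sums of int_0^1 dv / (1 + s v) = ln (1 + s) / s. *)
Lemma cvg_ln_div (R : realType) (s : R) : 0 < s ->
  \sum_(k < N.+1) (k.+1%:R^-1 / (s + N.+1%:R / k.+1%:R)) @[N --> \oo] -->
  ln (1 + s) / s.
Proof.
move=> s0; apply/cvgrPdist_le => e e0; near=> N.
have Nn0 : N.+1%:R != 0 :> R by rewrite pnatr_eq0.
set S := \sum_(k < _) _.
have d0 : 0 <= s / N.+1%:R by rewrite divr_ge0 // ltW.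
have := ln_riemann_bounds N.+1 d0.
have -> : N.+1%:R * (s / N.+1%:R) = s by rewrite mulrC divfK.
(* The sample point v = (k+1)/(N+1) corresponds to the Cauchy parameter t = 1/v, with weight
   1/(k+1). *)
have -> : \sum_(k < N.+1) (s / N.+1%:R) / (1 + k.+1%:R * (s / N.+1%:R)) = s * S.
  rewrite mulr_sumr; apply: eq_bigr => k _.
  have k0 : k.+1%:R != 0 :> R by rewrite pnatr_eq0.
  have : N.+1%:R + k.+1%:R * s != 0 :> R.
    by rewrite gt_eqF // ltr_wpDr ?ltr0Sn // mulr_ge0 // ltW.
  move: Nn0 k0; move: (N.+1%:R : R) (k.+1%:R : R) => u v u0 v0 uv0.
  by field; rewrite u0 v0 addrC mulrC uv0.
move=> /andP[lo up].
have hN : harmonic N <= e.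
  near: N; exact: cvgr_le (@cvg_harmonic R) _ _.
have lo' : S <= ln (1 + s) / s by rewrite ler_pdivlMr // mulrC.
have up' : ln (1 + s) / s <= S + harmonic N.
  rewrite ler_pdivrMr // (le_trans up) // mulrDl [s * S]mulrC lerD2l.
  rewrite [harmonic N * s]mulrC /= ler_piMr //.
  by rewrite gerBl invr_ge0; lra.
rewrite ger0_norm; lra.
Unshelve. all: by end_near. Qed.

(** * Strict positivity *)

Lemma det_ln_div_gt0 (R : realType) n (l x : 'I_n -> R) :
  (forall i, 0 < l i) -> (forall i j : 'I_n, (i < j)%N -> l j < l i) ->
  (forall i, 0 < x i) -> (forall i j : 'I_n, (i < j)%N -> x j < x i) ->
  0 < \det (\matrix_(i, j) (ln (1 + (l i + x j)) / (l i + x j))).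
Proof.
move=> l0 ld x0 xd.
have lx0 i j : 0 < l i + x j by rewrite addr_gt0.
apply: (@lt_le_trans _ _ (\det (\matrix_(i, j) (2^-1 / (l i + x j + 2))))).
  have -> : \matrix_(i, j) (2^-1 / (l i + x j + 2)) =
      2^-1 *: \matrix_(i, j) ((l i + 2) + x j)^-1.
    by apply/matrixP => i j; rewrite !mxE addrAC.
  rewrite detZ mulr_gt0 ?exprn_gt0 ?invr_gt0 //.
  apply: (@det_cauchy_gt0 _ _ (fun i => l i + 2) x) => // i j.
    by rewrite addrAC ltr_wpDr.
  by move=> ij; rewrite ltrD2r ld.
(* An even number 2M+2 of nodes makes t <= 2 equivalent to k >= M. These M+2 nodes weigh at least
   1/(2M+2) each, hence at least 1/2 together. *)
apply: (@ler_det_cvg R n (fun=> \matrix_(i, j) (2^-1 / (l i + x j + 2)))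
  (fun M => \matrix_(i, j) \sum_(k < (M.*2.+1).+1)
     (k.+1%:R^-1 / (l i + x j + M.*2.+2%:R / k.+1%:R)))).
- by move=> i j; exact: cvg_cst.
- move=> i j; rewrite mxE; under eq_fun do rewrite mxE.
  have := cvg_ln_div (lx0 i j).
  apply: (@cvg_comp _ _ _ (fun M => M.*2.+1)).
  by apply/cvgnyPge => A; exists A => // M /= AM; lia.
near=> M.
apply: ler_det_cauchy_sum => //.
- by move=> m; rewrite invr_ge0.
- by move=> m; rewrite divr_ge0.
- by rewrite invr_ge0.
apply: (@le_trans _ _ (\sum_(m < M.*2.+2 | (M <= m)%N) (M.*2.+2%:R)^-1)).
  rewrite -(big_geq_mkord _ _ predT (fun=> (M.*2.+2%:R)^-1)) sumr_const_nat.
  rewrite -[leRHS]mulr_natl ler_pdivlMr ?ltr0Sn //.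
  rewrite ler_pdivrMl // -natrM ler_nat -addnn.
  by lia.
rewrite big_mkcond [leRHS]big_mkcond /=; apply: ler_sum => m _.
case: (leqP M m) => Mm.
  rewrite ler_pdivrMr ?ltr0Sn // -natrM ler_nat.
  case: ifP => [_|/negP[]].
    by rewrite lef_pV2 ?posrE ?ltr0Sn // ler_nat.
  by lia.
by case: ifP => _; rewrite ?invr_ge0.
Unshelve. all: by end_near. Qed.

Theorem mainTheorem10 (R : realType) : STP_infty (@w7 R).
Proof.
move=> r l x _ l0 ld x0 xd.
have -> : \matrix_(i < r, j < r) w7 (l i) (x j) =
    \matrix_(i, j) (1 * (ln (1 + (l i + x j)) / (l i + x j)) *
      (x j / ln (1 + x j))).
  by apply/matrixP => i j; rewrite !mxE /w7 mul1r addrA.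
rewrite (det_scale _ _ (fun i j => ln (1 + (l i + x j)) / (l i + x j))).
rewrite big1_eq mul1r mulr_gt0 ?det_ln_div_gt0 //.
by apply: prodr_gt0 => j _; rewrite divr_gt0 // ln_gt0 // ltrDl.
Qed.
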